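(* (1) Let $X$ be a Riemannian manifold and $\phi:X\to\mathbb{C}$ a (smooth) mapping. Then $\phi$ is holomorphic if and only if $\phi$ is a harmonic morphism. (2) There is a graph $X$ having a holomorphic function $\phi:X\to\mathbb{C}$ which is not a harmonic morphism.
   Context: On a Riemannian manifold, $\Delta$ is the Laplace–Beltrami operator, applied to complex-valued functions by complex linearity. Functions on a graph are defined on its vertices (each of finite valency), and $\Delta f(x)=\frac{1}{\nu(x)}\sum_{y\sim x}(f(y)-f(x))$, where $y\sim x$ means adjacency and $\nu(x)$ is the valency of $x$. A function is harmonic if its Laplacian vanishes. A function $\phi:X\to\mathbb{C}$ is called holomorphic if both $\phi$ and its pointwise square $\phi^2$ are harmonic. A mapping $\phi:X\to\mathbb{C}$ is a harmonic morphism if for every open set $U\subset\mathbb{C}=\mathbb{R}^2$ and every real harmonic function $f:U\to\mathbb{R}$, the function $f\circ\phi$ is harmonic on $\phi^{-1}(U)$ (in the graph case: $\Delta(f\circ\phi)(x)=0$ at each vertex $x$ such that $\phi$ maps $x$ and all its neighbours into $U$). *)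

(* Defs.v *)
From mathcomp Require Import all_boot all_order all_algebra finmap.
From mathcomp Require Import all_classical all_reals all_analysis.
From mathcomp Require Import complex.

Set Implicit Arguments.
Unset Strict Implicit.
Unset Printing Implicit Defensive.

Import Order.TTheory GRing.Theory Num.Theory.
Import numFieldNormedType.Exports.

Local Open Scope classical_set_scope.
Local Open Scope ring_scope.
Local Open Scope complex_scope.

Section Euclidean.
Context {R : realType}.

Definition pderiv {n : nat} (a : 'I_n) (f : 'rV[R]_n -> R) : 'rV[R]_n -> R :=
  fun u => 'D_(delta_mx 0 a) f u.

(* Meant for an open set W; the values of f outside W are then irrelevant. *)
Fixpoint Ck {n : nat} (k : nat) (W : set 'rV[R]_n) (f : 'rV[R]_n -> R) : Prop :=
  if k is k'.+1 then
    (forall u, W u -> differentiable f u) /\ (forall a, Ck k' W (pderiv a f))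
  else forall u, W u -> {for u, continuous f}.

Definition smooth_on {n : nat} (W : set 'rV[R]_n) (f : 'rV[R]_n -> R) : Prop :=
  forall k, Ck k W f.

Definition plane_harmonic_on (U : set 'rV[R]_2) (f : 'rV[R]_2 -> R) : Prop :=
  Ck 2 U f /\ forall p, U p -> \sum_(a < 2) pderiv a (pderiv a f) p = 0.

(* The identification of the complex numbers with the real plane. *)
Definition C2plane (z : R[i]) : 'rV[R]_2 := \row_(a < 2) [:: complex.Re z; complex.Im z]`_a.

End Euclidean.

(* [chart_inv] is only meaningful on the image of the chart. *)
Record chart (R : realType) (n : nat) (M : topologicalType) := Chart {
  chart_dom : set M;
  chart_map :> M -> 'rV[R]_n;
  chart_inv : 'rV[R]_n -> M;
  chart_dom_open : open chart_dom;
  chart_img_open : open (chart_map @` chart_dom);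
  chart_mapK : forall x, chart_dom x -> chart_inv (chart_map x) = x;
  chart_map_continuous : {within chart_dom, continuous chart_map};
  chart_inv_continuous :
    {within chart_map @` chart_dom, continuous chart_inv} }.

Definition transition (R : realType) (n : nat) (M : topologicalType)
    (c d : chart R n M) : 'rV[R]_n -> 'rV[R]_n :=
  fun u => d (chart_inv c u).

(* The metric is given by its coefficient matrices in the charts of the atlas,
   as functions of the coordinates. Since ['J] acts on row vectors, on the
   right, the pull-back of the metric is [J *m G *m J^T]. *)
Record riemannian_manifold (R : realType) (n : nat) := RiemannianManifold {
  carrier :> topologicalType;
  carrier_hausdorff : hausdorff_space carrier;
  carrier_second_countable : @second_countable carrier;
  atlas_index : Type;
  atlas : atlas_index -> chart R n carrier;
  atlas_cover : forall x : carrier, exists i, chart_dom (atlas i) x;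
  atlas_smooth : forall i j (a : 'I_n),
    smooth_on (atlas i @` (chart_dom (atlas i) `&` chart_dom (atlas j)))
      (fun u => transition (atlas i) (atlas j) u 0 a);
  metric : atlas_index -> 'rV[R]_n -> 'M[R]_n;
  metric_smooth : forall i (a b : 'I_n),
    smooth_on (atlas i @` chart_dom (atlas i)) (fun u => metric i u a b);
  metric_sym : forall i x, chart_dom (atlas i) x ->
    (metric i (atlas i x))^T = metric i (atlas i x);
  metric_posdef : forall i x, chart_dom (atlas i) x ->
    forall v : 'rV[R]_n, v != 0 ->
      0 < (v *m metric i (atlas i x) *m v^T) 0 0;
  metric_compat : forall i j x,
    chart_dom (atlas i) x -> chart_dom (atlas j) x ->
    let J := 'J (transition (atlas i) (atlas j)) (atlas i x) in
    metric i (atlas i x) = J *m metric j (atlas j x) *m J^T }.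

Section Manifold.
Context {R : realType} {n : nat} (X : riemannian_manifold R n).

Definition manifold_Ck (k : nat) (W : set X) (f : X -> R) : Prop :=
  forall i : atlas_index X,
    Ck k (atlas i @` (chart_dom (atlas i) `&` W)) (f \o chart_inv (atlas i)).

Definition smooth_map (phi : X -> R[i]) : Prop :=
  forall k, manifold_Ck k setT (fun x => complex.Re (phi x)) /\
            manifold_Ck k setT (fun x => complex.Im (phi x)).

(* The Laplace-Beltrami operator at x, computed in the coordinates of the
   chart i, which has to contain x:
   (det g)^(-1/2) sum_a d_a ( sum_b (det g)^(1/2) g^(ab) d_b f ).
   Its value does not depend on the chart. *)
Definition laplace_beltrami (i : atlas_index X) (f : X -> R) (x : X) : R :=
  let G := metric i in
  let vol u := Num.sqrt (\det (G u)) in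
  let F := f \o chart_inv (atlas i) in
  (vol (atlas i x))^-1 *
  \sum_(a < n)
     pderiv a (fun u => \sum_(b < n) vol u * invmx (G u) a b * pderiv b F u)
       (atlas i x).

Definition claplace_beltrami (i : atlas_index X) (phi : X -> R[i]) (x : X)
    : R[i] :=
  laplace_beltrami i (fun y => complex.Re (phi y)) x +i*
  laplace_beltrami i (fun y => complex.Im (phi y)) x.

Definition harmonic_on (W : set X) (f : X -> R) : Prop :=
  manifold_Ck 2 W f /\
  forall i x, chart_dom (atlas i) x -> W x -> laplace_beltrami i f x = 0.

Definition charmonic (phi : X -> R[i]) : Prop :=
  [/\ manifold_Ck 2 setT (fun x => complex.Re (phi x)),
      manifold_Ck 2 setT (fun x => complex.Im (phi x)) &
      forall i x, chart_dom (atlas i) x -> claplace_beltrami i phi x = 0].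

Definition holomorphic (phi : X -> R[i]) : Prop :=
  charmonic phi /\ charmonic (fun x => phi x ^+ 2).

Definition harmonic_morphism (phi : X -> R[i]) : Prop :=
  forall (U : set 'rV[R]_2) (f : 'rV[R]_2 -> R),
    open U -> plane_harmonic_on U f ->
    harmonic_on ((C2plane \o phi) @^-1` U) (fun x => f (C2plane (phi x))).

End Manifold.

Record graph := Graph {
  vertex :> choiceType;
  adj : vertex -> vertex -> Prop;
  adj_sym : forall x y, adj x y -> adj y x;
  adj_irrefl : forall x, ~ adj x x;
  adj_finite : forall x, finite_set [set y | adj x y] }.

Section Graph.
Variable X : graph.

Definition valency (x : X) : nat := #|` fset_set [set y | adj x y]|%fset.

(* At an isolated vertex the sum is empty, and the Laplacian is 0. *)
Definition graph_laplacian {K : fieldType} (f : X -> K) (x : X) : K :=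
  (valency x)%:R^-1 * \sum_(y \in [set y | adj x y]) (f y - f x).

Definition graph_harmonic {K : fieldType} (f : X -> K) : Prop :=
  forall x, graph_laplacian f x = 0.

Definition graph_holomorphic {R : realType} (phi : X -> R[i]) : Prop :=
  graph_harmonic phi /\ graph_harmonic (fun x => phi x ^+ 2).

Definition graph_harmonic_morphism {R : realType} (phi : X -> R[i]) : Prop :=
  forall (U : set 'rV[R]_2) (f : 'rV[R]_2 -> R),
    open U -> plane_harmonic_on U f ->
    forall x, U (C2plane (phi x)) ->
      (forall y, adj x y -> U (C2plane (phi y))) ->
      graph_laplacian (fun y => f (C2plane (phi y))) x = 0.

End Graph.

(* Main.v *)
Require Import Defs.
From mathcomp Require Import all_boot all_order all_algebra finmap.
From mathcomp Require Import all_classical all_reals all_analysis.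
From mathcomp Require Import complex zify ring lra.

(* Write [phi = u + i v].  The functions [Re z], [Im z], [Re (z ^+ 2)] and
   [Im (z ^+ 2)] are harmonic in the plane, so a harmonic morphism is
   holomorphic.  Conversely, the chain rule
     L (f o phi) = f_u L u + f_v L v
                   + f_uu <du, du> + 2 f_uv <du, dv> + f_vv <dv, dv>,
   applied to the real and imaginary parts of [z ^+ 2], shows that a holomorphic
   [phi] satisfies <du, du> = <dv, dv> and <du, dv> = 0; the right-hand side is
   then <du, du> times the plane Laplacian of [f].
   On a graph the chain rule fails.  For the square lattice of the Gaussian
   integers, the increments 1, -1, i, -i have vanishing first and second power
   sums, but their fourth power sum is 4, so the harmonic function
   [Re (z ^+ 4)] does not pull back to a harmonic function. *)

Set Implicit Arguments.
Unset Strict Implicit.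
Unset Printing Implicit Defensive.

Import Order.TTheory GRing.Theory Num.Theory.
Import numFieldNormedType.Exports.

Local Open Scope classical_set_scope.
Local Open Scope ring_scope.

(** * Locality of the differential, and the calculus of functions of class C^k *)

Lemma near_eq_differentiable (K : numFieldType) (V W : normedModType K)
    (f g : V -> W) (x : V) :
  {near x, f =1 g} -> differentiable f x -> differentiable g x.
Proof.
move=> fg df.
(* The correction [g - f] vanishes near [x], so it is differentiable there with differential 0. *)
have -> : g = f + (g - f) by apply/funext => y /=; rewrite !fctE addrC subrK.
apply: differentiableD => //.
have fg0 : \forall h \near (0 : V), f (h + x) = g (h + x).
  have : \forall y \near x, f y = g y := fg.
  by rewrite (near_shift 0 x) subr0.
have gf0 : (g - f) \o shift x = cst ((g - f) x) + \0 +o_ (0 : V) id.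
  apply/eqaddoP => e e0; near=> h.
  rewrite !fctE /= (nbhs_singleton fg) subrr addr0 subr0.
  by rewrite (near fg0 h)// subrr normr0 mulr_ge0// ltW.
apply/diff_locallyP; rewrite (@diff_unique _ _ _ _ (\0)) //.
- by split => //; apply: cst_continuous.
- exact: cst_continuous.
Unshelve. all: by end_near. Qed.

Section CkTheory.
Context {R : realType} {n : nat}.
Implicit Types (V W : set 'rV[R]_n) (f g : 'rV[R]_n -> R) (u : 'rV[R]_n).

Lemma near_eq_pderiv (a : 'I_n) f g u :
  {near u, f =1 g} -> pderiv a f u = pderiv a g u.
Proof. exact: near_eq_derive. Qed.

Lemma pderiv_cst (a : 'I_n) (c : R) u : pderiv a (fun=> c) u = 0.
Proof. exact: derive_cst. Qed.

Lemma pderivD (a : 'I_n) f g u : differentiable f u -> differentiable g u ->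
  pderiv a (fun v => f v + g v) u = pderiv a f u + pderiv a g u.
Proof. by move=> df dg; apply: deriveD; exact: diff_derivable. Qed.

Lemma pderivM (a : 'I_n) f g u : differentiable f u -> differentiable g u ->
  pderiv a (fun v => f v * g v) u = pderiv a f u * g u + f u * pderiv a g u.
Proof.
move=> df dg; rewrite [LHS]deriveM; try exact: diff_derivable.
by rewrite addrC; congr (_ + _); rewrite mulrC.
Qed.

Lemma differentiable_bigsum (I : Type) (r : seq I) (P : pred I)
    (f : I -> 'rV[R]_n -> R) u :
  (forall i, P i -> differentiable (f i) u) ->
  differentiable (fun v => \sum_(i <- r | P i) f i v) u.
Proof.
move=> df; rewrite (_ : (fun _ => _) = \sum_(i <- r | P i) f i); last first.
  by apply/funext => v; rewrite fct_sumE.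
by elim/big_ind : _ => // *; exact: differentiableD.
Qed.

Lemma differentiable_bigprod (I : Type) (r : seq I) (P : pred I)
    (f : I -> 'rV[R]_n -> R) u :
  (forall i, P i -> differentiable (f i) u) ->
  differentiable (fun v => \prod_(i <- r | P i) f i v) u.
Proof.
move=> df; elim: r => [|i r IH].
  by rewrite (_ : (fun _ => _) = cst 1)//; apply/funext => v; rewrite big_nil.
case/boolP : (P i) => Pi.
  rewrite (_ : (fun _ => _) = f i * (fun v => \prod_(i <- r | P i) f i v)).
    by apply: differentiableM => //; exact: df.
  by apply/funext => v; rewrite big_cons Pi.
rewrite (_ : (fun _ => _) = (fun v => \prod_(i <- r | P i) f i v)) //.
by apply/funext => v; rewrite big_cons (negbTE Pi).
Qed.

Lemma pderiv_sum (a : 'I_n) (I : Type) (r : seq I) (P : pred I)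
    (f : I -> 'rV[R]_n -> R) u :
  (forall i, P i -> differentiable (f i) u) ->
  pderiv a (fun v => \sum_(i <- r | P i) f i v) u =
  \sum_(i <- r | P i) pderiv a (f i) u.
Proof.
move=> df; elim: r => [|i r IH].
  rewrite big_nil (_ : (fun _ => _) = cst 0); first exact: pderiv_cst.
  by apply/funext => v; rewrite big_nil.
rewrite big_cons; case: ifPn => Pi.
  rewrite -IH -pderivD; [|exact: df|exact: differentiable_bigsum].
  by congr pderiv; apply/funext => v; rewrite big_cons Pi.
rewrite -IH; congr pderiv; apply/funext => v.
by rewrite big_cons (negbTE Pi).
Qed.

Lemma pderiv_coord (a b : 'I_n) u : pderiv a (fun v => v 0 b) u = (b == a)%:R.
Proof.
have := @derive_mx R 'rV[R]_n 1 n id u (delta_mx 0 a) (@derivable_id _ _ _ _).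
by rewrite derive_id => /matrixP /(_ 0 b); rewrite !mxE.
Qed.

Lemma Ck_sub k V W f : V `<=` W -> Ck k W f -> Ck k V f.
Proof.
move=> VW; elim: k f => [|k IH] f /=; first by move=> cf u /VW /cf.
by move=> [df cf]; split=> [u /VW /df //|a]; exact: IH.
Qed.

Lemma CkW k W f : Ck k.+1 W f -> Ck k W f.
Proof.
elim: k f => [|k IH] f [df cf].
  by move=> u Wu; apply: differentiable_continuous; exact: df.
by split => // a; apply: IH.
Qed.

Lemma Ck_differentiable k W f u : Ck k.+1 W f -> W u -> differentiable f u.
Proof. by move=> [df _] /df. Qed.

Lemma Ck_pderiv k W f a : Ck k.+1 W f -> Ck k W (pderiv a f).
Proof. by move=> [_ /(_ a)]. Qed.

Lemma Ck_continuous k W f u : Ck k W f -> W u -> {for u, continuous f}.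
Proof. by case: k => [/(_ u)//|k] [df _] /df /differentiable_continuous. Qed.

Lemma Ck_cst k W (c : R) : Ck k W (fun=> c).
Proof.
elim: k c => [|k IH] c; first by move=> u _; exact: cst_continuous.
split=> [u _|a]; first exact: differentiable_cst.
rewrite (_ : pderiv a _ = fun=> 0) //.
by apply/funext => u; exact: pderiv_cst.
Qed.

Lemma Ck_coord k W (b : 'I_n) : Ck k W (fun v => v 0 b).
Proof.
case: k => [|k]; first by move=> u _; exact: coord_continuous.
split=> [u _|a]; first exact: differentiable_coord.
rewrite (_ : pderiv a _ = fun=> (b == a)%:R); first exact: Ck_cst.
by apply/funext => u; exact: pderiv_coord.
Qed.

Section Open.
Variable W : set 'rV[R]_n.
Hypothesis Wopen : open W.

Lemma near_open_eq f g u : {in W, f =1 g} -> W u -> {near u, f =1 g}.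
Proof.
move=> fg Wu; apply: filterS (open_nbhs_nbhs (conj Wopen Wu)) => v Wv.
by apply: fg; rewrite inE.
Qed.

(** On an open set, agreement on the set is agreement near each of its points, so it passes to all
    partial derivatives. Below, this allows a derivative to be replaced by a formula valid on [W]
    only. *)
Lemma eq_Ck k f g : {in W, f =1 g} -> Ck k W f -> Ck k W g.
Proof.
elim: k f g => [|k IH] f g fg.
  move=> cf u Wu; have := cf u Wu.
  rewrite /prop_for /continuous_at (fg u) ?inE// => fu.
  apply: cvg_trans fu.
  by apply: near_eq_cvg; [exact: (nbhs_filter u)|exact: (near_open_eq fg Wu)].
move=> [df cf]; split=> [u Wu|a].
  exact: near_eq_differentiable (near_open_eq fg Wu) (df _ Wu).
apply: IH (cf a) => u; rewrite inE => Wu.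
by apply: near_eq_pderiv; exact: near_open_eq.
Qed.

Lemma CkD k f g : Ck k W f -> Ck k W g -> Ck k W (fun u => f u + g u).
Proof.
elim: k f g => [|k IH] f g.
  by move=> cf cg u Wu; apply: continuousD; [exact: cf|exact: cg].
move=> [df cf] [dg cg]; split=> [u Wu|a].
  by apply: differentiableD; [exact: df|exact: dg].
apply: eq_Ck (IH _ _ (cf a) (cg a)) => u; rewrite inE => Wu.
by rewrite pderivD; [|exact: df|exact: dg].
Qed.

Lemma CkM k f g : Ck k W f -> Ck k W g -> Ck k W (fun u => f u * g u).
Proof.
elim: k f g => [|k IH] f g.
  by move=> cf cg u Wu; apply: continuousM; [exact: cf|exact: cg].
move=> Cf Cg; have [df cf] := Cf; have [dg cg] := Cg; split=> [u Wu|a].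
  by apply: differentiableM; [exact: df|exact: dg].
(* Each Leibniz term pairs a derivative, of class [k], with a function of class [k.+1], lowered by
   [CkW] to fit the induction hypothesis. *)
have := CkD (IH _ _ (cf a) (CkW Cg)) (IH _ _ (CkW Cf) (cg a)).
apply: eq_Ck => u; rewrite inE => Wu.
by rewrite pderivM; [|exact: df|exact: dg].
Qed.

Lemma Ck_sum k (I : Type) (r : seq I) (P : pred I) (f : I -> 'rV[R]_n -> R) :
  (forall i, P i -> Ck k W (f i)) ->
  Ck k W (fun u => \sum_(i <- r | P i) f i u).
Proof.
move=> cf; elim: r => [|i r IH].
  by apply: eq_Ck (Ck_cst k W 0) => u _; rewrite big_nil.
case/boolP : (P i) => Pi.
  by apply: eq_Ck (CkD (cf i Pi) IH) => u _; rewrite big_cons Pi.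
by apply: eq_Ck IH => u _; rewrite big_cons (negbTE Pi).
Qed.

End Open.

End CkTheory.

(** * The chain rule for partial derivatives *)

Section ChainRule.
Context {R : realType} {n m : nat}.
Variable F : 'rV[R]_n -> 'rV[R]_m.

Lemma differentiable_row u :
  (forall c, differentiable (fun v => F v 0 c) u) -> differentiable F u.
Proof.
move=> dF; rewrite (_ : F = \sum_(c < m) (fun v => F v 0 c *: delta_mx 0 c)).
  by apply: differentiable_sum => c; exact: differentiableZl.
by apply/funext => v; rewrite fct_sumE -row_sum_delta.
Qed.

Lemma continuous_row u :
  (forall c, {for u, continuous (fun v => F v 0 c)}) -> {for u, continuous F}.
Proof.
move=> cF; rewrite (_ : F = \sum_(c < m) (fun v => F v 0 c *: delta_mx 0 c)).
  elim/big_ind : _ => [|f g cf cg|c _]; first exact: cst_continuous.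
    exact: continuousD.
  by apply: continuousZr_tmp; exact: cF.
by apply/funext => v; rewrite fct_sumE -row_sum_delta.
Qed.

Lemma pderiv_comp (a : 'I_n) (f : 'rV[R]_m -> R) u :
  (forall c, differentiable (fun v => F v 0 c) u) ->
  differentiable f (F u) ->
  pderiv a (f \o F) u =
  \sum_(c < m) pderiv c f (F u) * pderiv a (fun v => F v 0 c) u.
Proof.
move=> dF df; have dFu := differentiable_row dF.
rewrite /pderiv deriveE; last exact: differentiable_comp.
(* The derivative of [F] along a basis row is the row of the derivatives of its components; it is
   expanded in the basis and the linear map ['d f] is applied termwise. *)
rewrite diff_comp //= -(deriveE _ dFu) (derive_mx (diff_derivable dFu)).
rewrite [X in 'd f _ X]row_sum_delta linear_sum /=; apply: eq_bigr => c _.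
by rewrite linearZ /= mxE mulrC (deriveE _ df).
Qed.

(** Induction on [k], for all [f] at once: the chain rule writes a derivative of [f \o F] through
    the composites [pderiv c f \o F], which the induction hypothesis covers. *)
Lemma Ck_comp k (V : set 'rV[R]_n) (U : set 'rV[R]_m) (f : 'rV[R]_m -> R) :
  open V -> V `<=` F @^-1` U ->
  (forall c, Ck k V (fun v => F v 0 c)) -> Ck k U f -> Ck k V (f \o F).
Proof.
move=> Vo VU; elim: k f => [|k IH] f cF cf.
  move=> u Vu; apply: continuous_comp; last exact: cf (VU _ Vu).
  by apply: continuous_row => c; exact: cF.
have dF c u : V u -> differentiable (fun v => F v 0 c) u.
  exact: Ck_differentiable (cF c).
have df p : U p -> differentiable f p.
  by move=> Up; exact: Ck_differentiable cf Up.
split=> [u Vu|a].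
  apply: differentiable_comp; last exact/df/VU.
  by apply: differentiable_row => c; exact: dF.
have : Ck k V (fun u =>
    \sum_(c < m) (pderiv c f \o F) u * pderiv a (fun v => F v 0 c) u).
  apply: Ck_sum => // c _; apply: CkM => //; last exact: Ck_pderiv.
  by apply: IH => [d|]; [exact/CkW/cF|exact: Ck_pderiv].
apply: eq_Ck => // u; rewrite inE => Vu.
by rewrite pderiv_comp // => [c|]; [exact: dF|exact/df/VU].
Qed.

End ChainRule.

(** * The harmonic polynomials Re z^k and Im z^k *)

Lemma sum_ord2 (V : nmodType) (F : 'I_2 -> V) : \sum_(a < 2) F a = F 0 + F 1.
Proof.
by rewrite !big_ord_recl big_ord0 addr0; congr (_ + F _); exact: val_inj.
Qed.

Section ComplexPowers.
Context {R : realType}.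

Definition plane2C (p : 'rV[R]_2) : R[i] := Complex (p 0 0) (p 0 1).

Definition Re_pow (k : nat) (p : 'rV[R]_2) : R := complex.Re (plane2C p ^+ k).

Definition Im_pow (k : nat) (p : 'rV[R]_2) : R := complex.Im (plane2C p ^+ k).

Lemma C2planeK : cancel C2plane plane2C.
Proof. by case=> x y; rewrite /plane2C !mxE. Qed.

(** The factor [- 1] presents the difference as a sum of products, the shape that [CkD], [CkM],
    [pderivD] and [pderivM] treat. *)
Lemma Re_powS k p :
  Re_pow k.+1 p = p 0 0 * Re_pow k p + - 1 * (p 0 1 * Im_pow k p).
Proof.
by rewrite mulN1r /Re_pow /Im_pow exprS; case: (plane2C p ^+ k).
Qed.

Lemma Im_powS k p :
  Im_pow k.+1 p = p 0 0 * Im_pow k p + p 0 1 * Re_pow k p.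
Proof.
by rewrite /Re_pow /Im_pow exprS; case: (plane2C p ^+ k).
Qed.

Lemma Ck_pow k m : Ck m setT (Re_pow k) /\ Ck m setT (Im_pow k).
Proof.
elim: k => [|k [cR cI]]; first by split; exact: Ck_cst.
split.
  apply: (eq_Ck openT (f := fun p =>
    p 0 0 * Re_pow k p + - 1 * (p 0 1 * Im_pow k p))) => [p _|].
    by rewrite Re_powS.
  by do ?[apply: CkD | apply: CkM | apply: Ck_coord | apply: Ck_cst
         | exact: openT].
apply: (eq_Ck openT (f := fun p =>
  p 0 0 * Im_pow k p + p 0 1 * Re_pow k p)) => [p _|].
  by rewrite Im_powS.
by do ?[apply: CkD | apply: CkM | apply: Ck_coord | exact: openT].
Qed.

Lemma differentiable_pow k p :
  differentiable (Re_pow k) p /\ differentiable (Im_pow k) p.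
Proof.
have [cR cI] := Ck_pow k 1.
by split; [exact: Ck_differentiable cR _|exact: Ck_differentiable cI _].
Qed.

(* The Cauchy-Riemann equations for [z ^+ k]. *)
Lemma pderiv_pow k p :
  [/\ pderiv 0 (Re_pow k) p = k%:R * Re_pow k.-1 p,
      pderiv 0 (Im_pow k) p = k%:R * Im_pow k.-1 p,
      pderiv 1 (Re_pow k) p = - k%:R * Im_pow k.-1 p &
      pderiv 1 (Im_pow k) p = k%:R * Re_pow k.-1 p].
Proof.
elim: k => [|k [R0 I0 R1 I1]].
  by rewrite oppr0 !mul0r; split; [exact: (pderiv_cst 0 1)
    |exact: (pderiv_cst 0 0)|exact: (pderiv_cst 1 1)|exact: (pderiv_cst 1 0)].
have [dR dI] := differentiable_pow k p.
have dc (b : 'I_2) : differentiable (fun q : 'rV[R]_2 => q 0 b) p.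
  exact: differentiable_coord.
have dRS a : pderiv a (Re_pow k.+1) p =
    (0 == a)%:R * Re_pow k p + p 0 0 * pderiv a (Re_pow k) p -
    ((1 == a)%:R * Im_pow k p + p 0 1 * pderiv a (Im_pow k) p).
  rewrite (_ : Re_pow k.+1 = fun q =>
    q 0 0 * Re_pow k q + - 1 * (q 0 1 * Im_pow k q)); last first.
    by apply/funext => q; rewrite Re_powS.
  have dRR := differentiableM (dc 0) dR.
  have dII := differentiableM (dc 1) dI.
  rewrite pderivD //; last exact: differentiableM.
  rewrite pderivM // pderivM // pderivM // !pderiv_coord.
  by rewrite pderiv_cst mul0r add0r mulN1r.
have dIS a : pderiv a (Im_pow k.+1) p =
    (0 == a)%:R * Im_pow k p + p 0 0 * pderiv a (Im_pow k) p +
    ((1 == a)%:R * Re_pow k p + p 0 1 * pderiv a (Re_pow k) p).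
  rewrite (_ : Im_pow k.+1 = fun q =>
    q 0 0 * Im_pow k q + q 0 1 * Re_pow k q); last first.
    by apply/funext => q; rewrite Im_powS.
  have dRI := differentiableM (dc 0) dI.
  have dIR := differentiableM (dc 1) dR.
  by rewrite pderivD // pderivM // pderivM // !pderiv_coord.
rewrite !dRS !dIS !R0 !R1 !I0 !I1 /=.
(* Recombining z * z^(k-1) into z^k needs [k > 0]; for [k = 0] the terms with the truncated exponent
   carry the coefficient 0. *)
case: k {R0 R1 I0 I1 dR dI dRS dIS} => [|k] /=.
  by split; ring.
by rewrite !Re_powS !Im_powS; split; ring.
Qed.

(** For [k < 2] the exponent [k.-2] is truncated, but the coefficient is 0. Mixed derivatives are
    computed in both orders because the second-order chain rule produces both. *)
Lemma pderiv2_pow k p :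
  [/\ pderiv 0 (pderiv 0 (Re_pow k)) p = (k * k.-1)%:R * Re_pow k.-2 p,
      pderiv 0 (pderiv 0 (Im_pow k)) p = (k * k.-1)%:R * Im_pow k.-2 p,
      pderiv 1 (pderiv 1 (Re_pow k)) p = - (k * k.-1)%:R * Re_pow k.-2 p &
      pderiv 1 (pderiv 1 (Im_pow k)) p = - (k * k.-1)%:R * Im_pow k.-2 p] /\
  [/\ pderiv 0 (pderiv 1 (Re_pow k)) p = - (k * k.-1)%:R * Im_pow k.-2 p,
      pderiv 0 (pderiv 1 (Im_pow k)) p = (k * k.-1)%:R * Re_pow k.-2 p,
      pderiv 1 (pderiv 0 (Re_pow k)) p = - (k * k.-1)%:R * Im_pow k.-2 p &
      pderiv 1 (pderiv 0 (Im_pow k)) p = (k * k.-1)%:R * Re_pow k.-2 p].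
Proof.
have [dR dI] := differentiable_pow k.-1 p.
have [R0 I0 R1 I1] := pderiv_pow k.-1 p.
have dZ a (c : R) f : differentiable f p ->
    pderiv a (fun q => c * f q) p = c * pderiv a f p.
  move=> df; rewrite pderivM //.
  by rewrite pderiv_cst mul0r add0r.
have ER0 : pderiv 0 (Re_pow k) = fun q => k%:R * Re_pow k.-1 q.
  by apply/funext => q; case: (pderiv_pow k q).
have EI0 : pderiv 0 (Im_pow k) = fun q => k%:R * Im_pow k.-1 q.
  by apply/funext => q; case: (pderiv_pow k q).
have ER1 : pderiv 1 (Re_pow k) = fun q => - k%:R * Im_pow k.-1 q.
  by apply/funext => q; case: (pderiv_pow k q).
have EI1 : pderiv 1 (Im_pow k) = fun q => k%:R * Re_pow k.-1 q.
  by apply/funext => q; case: (pderiv_pow k q).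
by rewrite ER0 EI0 ER1 EI1 !dZ // R0 I0 R1 I1 natrM; split; split; ring.
Qed.

Lemma Re_pow_harmonic k : plane_harmonic_on setT (Re_pow k).
Proof.
split=> [|p _]; first by have [] := Ck_pow k 2.
by have [[e0 _ e1 _] _] := pderiv2_pow k p; rewrite sum_ord2 e0 e1; ring.
Qed.

Lemma Im_pow_harmonic k : plane_harmonic_on setT (Im_pow k).
Proof.
split=> [|p _]; first by have [] := Ck_pow k 2.
by have [[_ e0 _ e1] _] := pderiv2_pow k p; rewrite sum_ord2 e0 e1; ring.
Qed.

End ComplexPowers.

(** * The second-order chain rule for operators in divergence form *)

Section DivergenceForm.
Context {R : realType} {n : nat}.
Variable h : 'I_n -> 'I_n -> 'rV[R]_n -> R.

(** For h = sqrt(det g) g^(ab), the Laplace-Beltrami operator is this operator divided by sqrt(det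
    g). *)
Definition divform (f : 'rV[R]_n -> R) (p : 'rV[R]_n) : R :=
  \sum_(a < n) pderiv a (fun u => \sum_(b < n) h a b u * pderiv b f u) p.

(** For the same [h], this is sqrt(det g) times the inner product of the gradients. *)
Definition gradform (f g : 'rV[R]_n -> R) (p : 'rV[R]_n) : R :=
  \sum_(a < n) \sum_(b < n) h a b p * pderiv a f p * pderiv b g p.

Lemma gradformC f g p : (forall a b, h a b p = h b a p) ->
  gradform f g p = gradform g f p.
Proof.
move=> hC; rewrite /gradform exchange_big /=; apply: eq_bigr => a _.
by apply: eq_bigr => b _; rewrite hC mulrAC.
Qed.

(** By the chain rule, the flux of [f \o F] is the combination of the fluxes of the components of
    [F] with coefficients [pderiv c f \o F]. In its divergence, differentiating the fluxes gives the
    first sum, differentiating the coefficients the second. *)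
Lemma divform_comp m (F : 'rV[R]_n -> 'rV[R]_m) (f : 'rV[R]_m -> R)
    (V : set 'rV[R]_n) (U : set 'rV[R]_m) (p : 'rV[R]_n) :
  open V -> V p -> V `<=` F @^-1` U ->
  (forall c, Ck 2 V (fun u => F u 0 c)) -> Ck 2 U f ->
  (forall a b, differentiable (h a b) p) ->
  divform (f \o F) p =
  \sum_(c < m) pderiv c f (F p) * divform (fun u => F u 0 c) p +
  \sum_(c < m) \sum_(d < m) pderiv d (pderiv c f) (F p) *
    gradform (fun u => F u 0 d) (fun u => F u 0 c) p.
Proof.
move=> Vo Vp VU cF cf dh.
have dF c u : V u -> differentiable (fun v => F v 0 c) u.
  by move=> Vu; exact: Ck_differentiable (cF c) Vu.
have dF2 b c u : V u -> differentiable (pderiv b (fun v => F v 0 c)) u.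
  by move=> Vu; exact: Ck_differentiable (Ck_pderiv b (cF c)) Vu.
have df q : U q -> differentiable f q.
  by move=> Uq; exact: Ck_differentiable cf Uq.
have df2 c q : U q -> differentiable (pderiv c f) q.
  by move=> Uq; exact: Ck_differentiable (Ck_pderiv c cf) Uq.
have UFp : U (F p) by exact: VU.
have dFp : differentiable F p by apply: differentiable_row => c; exact: dF.
pose A a c u := \sum_(b < n) h a b u * pderiv b (fun v => F v 0 c) u.
have dA a c : differentiable (A a c) p.
  apply: differentiable_bigsum => b _.
  by apply: differentiableM; [exact: dh|exact: dF2].
have dfF c : differentiable (fun u => pderiv c f (F u)) p.
  by apply: differentiable_comp => //; exact: df2.
(* The identity is needed on a neighbourhood of [p], not just at [p], since it is differentiated
   next. *)
have flux a : {near p,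
    (fun u => \sum_(b < n) h a b u * pderiv b (f \o F) u) =1
    (fun u => \sum_(c < m) pderiv c f (F u) * A a c u)}.
  apply: (near_open_eq Vo) => // u; rewrite inE => Vu.
  under eq_bigr => b _.
    rewrite pderiv_comp; [|by move=> c; exact: dF|exact/df/VU].
    rewrite mulr_sumr; over.
  rewrite exchange_big /=; apply: eq_bigr => c _.
  by rewrite mulr_sumr; apply: eq_bigr => b _; rewrite mulrCA.
have step a :
    pderiv a (fun u => \sum_(b < n) h a b u * pderiv b (f \o F) u) p =
    \sum_(c < m) (pderiv c f (F p) * pderiv a (A a c) p +
      \sum_(d < m) pderiv d (pderiv c f) (F p) *
        (\sum_(b < n) h a b p * pderiv a (fun v => F v 0 d) p *
           pderiv b (fun v => F v 0 c) p)).
  rewrite (near_eq_pderiv a (flux a)) pderiv_sum => [|c _]; last first.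
    by apply: differentiableM; [exact: dfF|exact: dA].
  apply: eq_bigr => c _; rewrite pderivM // addrC; congr (_ + _).
  have -> : pderiv a (fun u => pderiv c f (F u)) p = _ :=
    pderiv_comp a (fun d => dF d p Vp) (df2 c _ UFp).
  rewrite mulr_suml; apply: eq_bigr => d _.
  rewrite -mulrA; congr (_ * _); rewrite mulr_sumr; apply: eq_bigr => b _.
  by rewrite mulrCA mulrA.
rewrite [LHS](eq_bigr _ (fun a _ => step a)) exchange_big -big_split /=.
apply: eq_bigr => c _; rewrite big_split /= -mulr_sumr; congr (_ + _).
by rewrite exchange_big /=; apply: eq_bigr => d _; rewrite -mulr_sumr.
Qed.

End DivergenceForm.

(** * Differentiability of determinants and inverse matrices *)

Section MatrixFunctions.
Context {R : realType} {n : nat}.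
Implicit Types u : 'rV[R]_n.

(** The determinant is by definition the Leibniz sum, a polynomial in the entries. *)
Lemma differentiable_det m (A : 'rV[R]_n -> 'M[R]_m) u :
  (forall a b, differentiable (fun v => A v a b) u) ->
  differentiable (fun v => \det (A v)) u.
Proof.
move=> dA; apply: differentiable_bigsum => s _.
by apply: differentiableM => //; exact: differentiable_bigprod.
Qed.

(** By Cramer's formula, an entry of the inverse is a cofactor divided by the determinant. *)
Lemma differentiable_invmx m (A : 'rV[R]_n -> 'M[R]_m) u a b :
  (forall c d, differentiable (fun v => A v c d) u) -> \det (A u) != 0 ->
  differentiable (fun v => invmx (A v) a b) u.
Proof.
move=> dA detA; have ddet := differentiable_det dA.
have dadj : differentiable
    (fun v => (-1) ^+ (b + a) * \det (row' b (col' a (A v)))) u.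
  apply: differentiableM => //; apply: differentiable_det => c d.
  by under eq_fun do rewrite !mxE.
apply: (@near_eq_differentiable _ _ _ (fun v => (\det (A v))^-1 *
    ((-1) ^+ (b + a) * \det (row' b (col' a (A v)))))).
  (* On a singular matrix [invmx] returns the matrix itself; by continuity of the determinant,
     Cramer's formula holds near [u]. *)
  have : \forall v \near u, \det (A v) != 0.
    have /(_ _ (open_nbhs_nbhs (conj (@open_neq R 0) detA))) :=
      differentiable_continuous ddet.
    by [].
  by apply: filterS => v dv; rewrite /invmx unitmxE unitfE dv !mxE.
by apply: differentiableM => //; exact: differentiableV.
Qed.

End MatrixFunctions.

(** * The Laplace-Beltrami operator and the chain rule in a chart *)

Section ManifoldChain.
Context {R : realType} {n : nat} (X : riemannian_manifold R n).
Implicit Types (phi : X -> R[i]) (i : atlas_index X).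

Definition flux_coef i (a b : 'I_n) (u : 'rV[R]_n) : R :=
  Num.sqrt (\det (metric i u)) * invmx (metric i u) a b.

Lemma laplace_beltramiE i f x :
  laplace_beltrami i f x = (Num.sqrt (\det (metric i (atlas i x))))^-1 *
    divform (flux_coef i) (f \o chart_inv (atlas i)) (atlas i x).
Proof. by []. Qed.

Lemma flux_coefC i x a b : chart_dom (atlas i) x ->
  flux_coef i a b (atlas i x) = flux_coef i b a (atlas i x).
Proof.
move=> ix; congr (_ * _).
by rewrite -[in LHS](Defs.metric_sym ix) -trmx_inv mxE.
Qed.

(** Positivity of the determinant serves twice: the square root is differentiable there, and the
    metric matrix is invertible. *)
Lemma flux_coef_differentiable i x a b : chart_dom (atlas i) x ->
  0 < \det (metric i (atlas i x)) ->
  differentiable (flux_coef i a b) (atlas i x).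
Proof.
move=> ix det_gt0.
have dG c d : differentiable (fun v => metric i v c d) (atlas i x).
  by apply: Ck_differentiable (metric_smooth i c d 1) _; exists x.
apply: differentiableM; last by apply: differentiable_invmx; rewrite ?gt_eqF.
apply: (@differentiable_comp _ _ _ _ (fun v => \det (metric i v)) Num.sqrt).
  exact: differentiable_det.
by apply/derivable1_diffP; apply: ex_derive; exact: is_derive1_sqrt.
Qed.

Definition chart_rep phi i (u : 'rV[R]_n) : 'rV[R]_2 :=
  C2plane (phi (chart_inv (atlas i) u)).

(** Up to the factor sqrt(det g), the Laplacian of Re phi ([c = 0]) or Im phi ([c = 1]). *)
Definition chart_flux phi i (x : X) (c : 'I_2) : R :=
  divform (flux_coef i) (fun u => chart_rep phi i u 0 c) (atlas i x).

(** Up to the same factor, the Gram matrix of the gradients of Re phi and Im phi. *)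
Definition chart_gram phi i (x : X) (c d : 'I_2) : R :=
  gradform (flux_coef i) (fun u => chart_rep phi i u 0 c)
    (fun u => chart_rep phi i u 0 d) (atlas i x).

Lemma chart_rep0 phi i : (fun u => chart_rep phi i u 0 0) =
  (fun y => complex.Re (phi y)) \o chart_inv (atlas i).
Proof. by apply/funext => u; rewrite mxE. Qed.

Lemma chart_rep1 phi i : (fun u => chart_rep phi i u 0 1) =
  (fun y => complex.Im (phi y)) \o chart_inv (atlas i).
Proof. by apply/funext => u; rewrite mxE. Qed.

Lemma ord2P (c : 'I_2) : c = 0 \/ c = 1.
Proof. by case: c => [[|[|//]] lt]; [left|right]; exact: val_inj. Qed.

Lemma chart_rep_Ck phi i k c : smooth_map phi ->
  Ck k (atlas i @` chart_dom (atlas i)) (fun u => chart_rep phi i u 0 c).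
Proof.
move=> /(_ k) [/(_ i) cR /(_ i) cI]; rewrite !setIT in cR cI.
by have [->|->] := ord2P c; rewrite ?chart_rep0 ?chart_rep1.
Qed.

(** In the second form the set is visibly open, by continuity of [chart_rep] on the open image of
    the chart. *)
Lemma chart_image_preimage phi i (U : set 'rV[R]_2) :
  atlas i @` (chart_dom (atlas i) `&` (C2plane \o phi) @^-1` U) =
  (atlas i @` chart_dom (atlas i)) `&` chart_rep phi i @^-1` U.
Proof.
apply/seteqP; split=> [_ [x [ix Ux] <-]|_ [[x ix <-]]].
  by split; [exists x|rewrite /chart_rep /= chart_mapK].
by rewrite /chart_rep /= chart_mapK // => Ux; exists x.
Qed.

Lemma chart_image_preimage_open phi i (U : set 'rV[R]_2) :
  smooth_map phi -> open U ->
  open (atlas i @` (chart_dom (atlas i) `&` (C2plane \o phi) @^-1` U)).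
Proof.
move=> phiS Uo; rewrite chart_image_preimage openE => u [iu Uu].
apply: filterI.
  by apply: open_nbhs_nbhs; split => //; exact: chart_img_open.
have : {for u, continuous (chart_rep phi i)}.
  apply: continuous_row => c.
  exact: Ck_continuous (chart_rep_Ck i 0 c phiS) iu.
by apply; exact: open_nbhs_nbhs.
Qed.

Lemma manifold_Ck_comp phi k (U : set 'rV[R]_2) (f : 'rV[R]_2 -> R) :
  smooth_map phi -> open U -> Ck k U f ->
  manifold_Ck k ((C2plane \o phi) @^-1` U) (fun x => f (C2plane (phi x))).
Proof.
move=> phiS Uo cf i.
apply: (@Ck_comp _ _ _ (chart_rep phi i) _ _ U) => //.
- exact: chart_image_preimage_open.
- by rewrite chart_image_preimage => u [].
- move=> c; apply: Ck_sub (chart_rep_Ck i k c phiS).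
  by rewrite chart_image_preimage => u [].
Qed.

(** This is [divform_comp] for the two components of phi in the chart, with its sums written out. *)
Lemma divform_chart_rep phi i x (U : set 'rV[R]_2) (f : 'rV[R]_2 -> R) :
  smooth_map phi -> chart_dom (atlas i) x ->
  0 < \det (metric i (atlas i x)) ->
  open U -> U (C2plane (phi x)) -> Ck 2 U f ->
  let D c := pderiv c f (C2plane (phi x)) in
  let DD d c := pderiv d (pderiv c f) (C2plane (phi x)) in
  let Q := chart_gram phi i x in
  divform (flux_coef i) (f \o chart_rep phi i) (atlas i x) =
  D 0 * chart_flux phi i x 0 + D 1 * chart_flux phi i x 1 +
  (DD 0 0 * Q 0 0 + DD 1 0 * Q 1 0 + (DD 0 1 * Q 0 1 + DD 1 1 * Q 1 1)).
Proof.
move=> phiS ix det_gt0 Uo Ux cf D DD Q.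
transitivity (\sum_(c < 2) D c * chart_flux phi i x c +
    \sum_(c < 2) \sum_(d < 2) DD d c * Q d c); last first.
  by rewrite (sum_ord2 (fun c => D c * _)) sum_ord2
    (sum_ord2 (fun d => DD d 0 * _)) (sum_ord2 (fun d => DD d 1 * _)).
rewrite /D /DD.
have <- : chart_rep phi i (atlas i x) = C2plane (phi x).
  by rewrite /chart_rep chart_mapK.
apply: (divform_comp (V := _) _ _ _ _ cf).
- exact: chart_image_preimage_open phiS Uo.
- by exists x.
- by rewrite chart_image_preimage => u [].
- move=> c; apply: Ck_sub (chart_rep_Ck i 2 c phiS).
  by rewrite chart_image_preimage => u [].
- by move=> a b; exact: flux_coef_differentiable.
Qed.

End ManifoldChain.

(** * Holomorphic maps and harmonic morphisms on a manifold *)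

Section HolomorphicMorphism.
Context {R : realType} {n : nat} (X : riemannian_manifold R n).
Variable phi : X -> R[i].
Hypothesis phiS : smooth_map phi.

Lemma Re_pow_C2plane k x : Re_pow k (C2plane (phi x)) = complex.Re (phi x ^+ k).
Proof. by rewrite /Re_pow C2planeK. Qed.

Lemma Im_pow_C2plane k x : Im_pow k (C2plane (phi x)) = complex.Im (phi x ^+ k).
Proof. by rewrite /Im_pow C2planeK. Qed.

Lemma harmonic_morphism_pow k :
  harmonic_morphism phi -> charmonic (fun x => phi x ^+ k).
Proof.
move=> phiH.
have [cR lR] := phiH setT (Re_pow k) openT (Re_pow_harmonic k).
have [cI lI] := phiH setT (Im_pow k) openT (Im_pow_harmonic k).
rewrite preimage_setT in cR lR cI lI.
have eR : (fun x => complex.Re (phi x ^+ k)) =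
    fun x => Re_pow k (C2plane (phi x)).
  by apply/funext => x; rewrite Re_pow_C2plane.
have eI : (fun x => complex.Im (phi x ^+ k)) =
    fun x => Im_pow k (C2plane (phi x)).
  by apply/funext => x; rewrite Im_pow_C2plane.
split=> [||i x ix]; rewrite ?eR ?eI//.
by rewrite /claplace_beltrami eR eI lR// lI.
Qed.

Lemma harmonic_morphism_holomorphic : harmonic_morphism phi -> holomorphic phi.
Proof.
by move=> phiH; split; [exact: (harmonic_morphism_pow 1)
  |exact: (harmonic_morphism_pow 2)].
Qed.

(** A positive determinant makes the volume factor invertible, so it cancels and leaves the
    divergence form, to which the chain rule applies. *)
Lemma charmonic_divform (psi : X -> R[i]) i x : charmonic psi ->
  chart_dom (atlas i) x -> 0 < \det (metric i (atlas i x)) ->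
  divform (flux_coef i) ((fun y => complex.Re (psi y)) \o chart_inv (atlas i))
    (atlas i x) = 0 /\
  divform (flux_coef i) ((fun y => complex.Im (psi y)) \o chart_inv (atlas i))
    (atlas i x) = 0.
Proof.
move=> [_ _ /(_ i x)] lap ix det_gt0; move: (lap ix) => [].
rewrite !laplace_beltramiE.
have vol_neq0 : (Num.sqrt (\det (metric i (atlas i x))))^-1 != 0.
  by rewrite invr_eq0 gt_eqF// sqrtr_gt0.
have cancel (r : R) :
    (Num.sqrt (\det (metric i (atlas i x))))^-1 * r = 0 -> r = 0.
  by move/eqP; rewrite mulf_eq0 (negbTE vol_neq0) => /eqP.
by move=> /cancel ? /cancel ?.
Qed.

Lemma holomorphic_flux i x : holomorphic phi ->
  chart_dom (atlas i) x -> 0 < \det (metric i (atlas i x)) ->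
  chart_flux phi i x 0 = 0 /\ chart_flux phi i x 1 = 0.
Proof.
move=> [phi1 _] ix det_gt0; rewrite /chart_flux chart_rep0 chart_rep1.
exact: charmonic_divform.
Qed.

(* The Laplacian of the square gives [|grad Re phi| = |grad Im phi|] from its
   real part, and the orthogonality of the gradients from its imaginary part. *)
Lemma holomorphic_gram i x : holomorphic phi ->
  chart_dom (atlas i) x -> 0 < \det (metric i (atlas i x)) ->
  let Q := chart_gram phi i x in
  [/\ Q 0 0 = Q 1 1, Q 0 1 = 0 & Q 1 0 = 0].
Proof.
move=> phiH ix det_gt0 Q.
have [l0 l1] := holomorphic_flux phiH ix det_gt0.
have [_ phi2] := phiH.
have [l2R l2I] := charmonic_divform phi2 ix det_gt0.
have QC : Q 1 0 = Q 0 1 by apply: gradformC => a b; exact: flux_coefC.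
have [cR cI] := @Ck_pow R 2 2.
have fR : (fun y => complex.Re (phi y ^+ 2)) \o chart_inv (atlas i) =
    Re_pow 2 \o chart_rep phi i.
  by apply/funext => u; rewrite /= Re_pow_C2plane.
have fI : (fun y => complex.Im (phi y ^+ 2)) \o chart_inv (atlas i) =
    Im_pow 2 \o chart_rep phi i.
  by apply/funext => u; rewrite /= Im_pow_C2plane.
have [[r00 i00 r11 i11] [r01 i01 r10 i10]] := pderiv2_pow 2 (C2plane (phi x)).
have z0 : Re_pow 2.-2 (C2plane (phi x)) = 1 :> R by [].
have z1 : Im_pow 2.-2 (C2plane (phi x)) = 0 :> R by [].
rewrite fR (divform_chart_rep phiS ix det_gt0 openT I cR) in l2R.
rewrite fI (divform_chart_rep phiS ix det_gt0 openT I cI) in l2I.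
(* After substitution the real part reads 2 Q00 - 2 Q11 = 0 and the imaginary part 4 Q01 = 0. *)
rewrite -/Q l0 l1 QC r00 r11 r01 r10 z0 z1 muln1 in l2R.
rewrite -/Q l0 l1 QC i00 i11 i01 i10 z0 z1 muln1 in l2I.
rewrite QC; move: l2R l2I.
move: (pderiv 0 _ _) (pderiv 1 _ _) (pderiv 0 _ _) (pderiv 1 _ _).
move: (Q 0 0) (Q 0 1) (Q 1 1).
clear; move=> q00 q01 q11 d0 d1 e0 e1 eR eI; split; lra.
Qed.

Lemma holomorphic_harmonic_morphism : holomorphic phi -> harmonic_morphism phi.
Proof.
move=> phiH U f Uo [cf lf]; split; first exact: manifold_Ck_comp.
move=> i x ix Ux; rewrite laplace_beltramiE.
(* The square root of a negative number is 0, so the Laplacian is trivially 0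
   unless the determinant is positive; that it always is need not be shown. *)
have [det_le0|det_gt0] := leP (\det (metric i (atlas i x))) 0.
  by rewrite ler0_sqrtr// invr0 mul0r.
have [Q00 Q01 Q10] := holomorphic_gram phiH ix det_gt0.
have [l0 l1] := holomorphic_flux phiH ix det_gt0.
have lfx := lf _ Ux; rewrite sum_ord2 in lfx.
(* With zero fluxes and Gram matrix [q] times the identity, the chain rule reduces to [q] times the
   plane Laplacian of [f]. *)
have isotropic (d0 d1 d00 d01 d10 d11 q : R) : d00 + d11 = 0 ->
    d0 * 0 + d1 * 0 + (d00 * q + d10 * 0 + (d01 * 0 + d11 * q)) = 0.
  by move=> dE; rewrite !mulr0 !addr0 !add0r -mulrDl dE mul0r.
have e := divform_chart_rep phiS ix det_gt0 Uo Ux cf.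
cbv beta zeta in e, Q01, Q10, Q00.
rewrite l0 l1 Q01 Q10 Q00 (isotropic _ _ _ _ _ _ _ lfx) in e.
by rewrite [X in _ * X]e mulr0.
Qed.

End HolomorphicMorphism.

(** * The counterexample on the square lattice *)

Section SquareLattice.

Definition square_nbrs (x : int * int) : seq (int * int) :=
  [:: (x.1 + 1, x.2); (x.1 - 1, x.2); (x.1, x.2 + 1); (x.1, x.2 - 1)].

Lemma square_nbrs_uniq x : uniq (square_nbrs x).
Proof.
case: x => a b; rewrite /= !inE !xpair_eqE !negb_or /=.
by lia.
Qed.

Lemma square_nbrs_sym x y : y \in square_nbrs x -> x \in square_nbrs y.
Proof.
by case: x y => [a b] [c d]; rewrite !inE !xpair_eqE /=; lia.
Qed.

Lemma square_nbrs_irrefl x : ~ x \in square_nbrs x.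
Proof. by case: x => [a b]; rewrite !inE !xpair_eqE /=; lia. Qed.

Lemma square_nbrs_finite x : finite_set [set y | y \in square_nbrs x].
Proof. exact: finite_seq. Qed.

Definition square_lattice : graph :=
  Graph square_nbrs_sym square_nbrs_irrefl square_nbrs_finite.

(** The list of neighbours has no repetition, so it may replace the finite set as the range of
    summation. *)
Lemma square_laplacian (K : fieldType) (f : square_lattice -> K)
    (x : square_lattice) :
  graph_laplacian f x =
  (valency x)%:R^-1 * \sum_(y <- square_nbrs x) (f y - f x).
Proof. by rewrite /graph_laplacian -fsbig_seq// square_nbrs_uniq. Qed.

(** This makes the factor in front of the Laplacian non-zero, so that it can be cancelled in the
    counterexample. *)
Lemma square_valency_gt0 (x : square_lattice) : (0 < valency x)%N.
Proof.
rewrite /valency cardfs_gt0; apply/fset0Pn; exists (x.1 + 1, x.2).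
rewrite in_fset_set; last exact: square_nbrs_finite.
by apply/mem_set; rewrite /= inE eqxx.
Qed.

Definition gauss (R : realType) (x : square_lattice) : R[i] :=
  Complex (x.1%:~R) (x.2%:~R).

Lemma gauss_holomorphic (R : realType) : graph_holomorphic (gauss R).
Proof.
have nbr (a b : int) : [/\ gauss R (a + 1, b) = gauss R (a, b) + 1,
    gauss R (a - 1, b) = gauss R (a, b) - 1,
    gauss R (a, b + 1) = gauss R (a, b) + Complex 0 1 &
    gauss R (a, b - 1) = gauss R (a, b) - Complex 0 1].
  by split; rewrite /gauss ?intrD ?intrB; congr Complex;
    rewrite /= ?addr0 ?subr0.
(* The increments 1, -1, w, -w have sum 0, and their squares have sum 2 + 2 w^2 = 0. *)
by split=> -[a b]; rewrite square_laplacian /square_nbrs !big_cons big_nil /=;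
  have [-> -> -> ->] := nbr a b; have := sqr_i R; set w := Complex 0 1 => w2;
  rewrite [X in _ * X](_ : _ = 0) ?mulr0//; ring: w2.
Qed.

Lemma gauss_not_harmonic_morphism (R : realType) :
  ~ graph_harmonic_morphism (gauss R).
Proof.
move=> /(_ setT (Re_pow 4) openT (Re_pow_harmonic 4) (0, 0) I (fun _ _ => I)).
rewrite square_laplacian => /eqP; rewrite mulf_eq0 invr_eq0 pnatr_eq0.
rewrite -[_ == 0%N]negbK -lt0n square_valency_gt0 /= => /eqP.
have Re_pow4 (p : 'rV[R]_2) : Re_pow 4 p =
    p 0 0 ^+ 4 - 6 * p 0 0 ^+ 2 * p 0 1 ^+ 2 + p 0 1 ^+ 4.
  by rewrite !(Re_powS, Im_powS) /Re_pow /Im_pow !expr0 /=; ring.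
(* Each neighbour of the origin has fourth power 1, so the sum supposed to be 0 equals 4. *)
rewrite /square_nbrs !big_cons big_nil !Re_pow4 !mxE /= !add0r.
lra.
Qed.

End SquareLattice.

Theorem theorem1p6 (R : realType) :
  (forall (n : nat) (X : riemannian_manifold R n) (phi : X -> complex R),
     smooth_map phi -> (holomorphic phi <-> harmonic_morphism phi)) /\
  (exists (X : graph) (phi : X -> complex R),
     graph_holomorphic phi /\ ~ graph_harmonic_morphism phi).
Proof.
split=> [n X phi phiS|].
  split; first exact: holomorphic_harmonic_morphism.
  exact: harmonic_morphism_holomorphic.
exists square_lattice, (gauss R).
by split; [exact: gauss_holomorphic|exact: gauss_not_harmonic_morphism].
Qed.
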